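(* Let $G$ be an infinite group of cardinality $\kappa$. If either $\kappa$ is regular or $G$ is a free group, then $G$ admits no maximal left invariant $\kappa$-bounded topology.
   Context: A topological space $X$ with no isolated points is called maximal if $X$ has an isolated point in any (strictly) stronger topology. A topology $\tau$ on a group $G$ is called left invariant if, for every $g\in G$, the left shift $x\mapsto gx$, $G\to G$, is continuous in $\tau$; a group endowed with a left invariant topology is called a left topological group. A left invariant topology on $G$ is called maximal if $G$ with this topology is maximal as a topological space (in particular, it has no isolated points). For a group $G$ of cardinality $\kappa$, a subset $A\subseteq G$ is left $\kappa$-large if there exists $F\subseteq G$ with $|F|<\kappa$ such that $G=FA$. A left topological group $G$ of cardinality $\kappa$ (or its topology) is called $\kappa$-bounded if each neighborhood $U$ of the identity $e$ (equivalently, each non-empty open subset of $G$) is left $\kappa$-large. An infinite cardinal is regular if it equals its cofinality. *)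

(* Defs.v *)
From HB Require Import structures.
From mathcomp Require Import all_boot monoid.
From mathcomp Require Import all_classical.
From mathcomp Require Import topology_structure.

Set Implicit Arguments.
Unset Strict Implicit.
Unset Printing Implicit Defensive.

Local Open Scope classical_set_scope.
Local Open Scope card_scope.
Local Open Scope group_scope.

(* The topologies on a given carrier are the library's [topologicalType]       *)
(* structures over it, so that several of them can be compared on one [T].     *)
Definition topology (T : Type) := Topological.axioms_ T.

Coercion space_of (T : Type) (tau : topology T) : topologicalType :=
  Topological.Pack tau.

Definition stronger (T : Type) (tau' tau : topology T) : Prop :=
  @open tau `<` @open tau'.

Definition no_isolated_points (X : topologicalType) : Prop :=
  isolated [set: X] = set0.

Definition maximal_topology (T : Type) (tau : topology T) : Prop :=
  no_isolated_points tau /\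
  forall tau' : topology T,
    stronger tau' tau -> exists x : tau', isolated [set: tau'] x.

Definition card_lt (T U : Type) (A : set T) (B : set U) : Prop :=
  (A #<= B) /\ ~ (B #<= A).

Section CardinalOfType.
Variable T : Type.
Implicit Types (R : rel T) (C : set T).

(* [R] (non-strict) exhibits the cardinal [#|T|] as an initial ordinal: it is  *)
(* a well-order of [T] all of whose proper initial segments are smaller.       *)
Definition initial_well_order R : Prop :=
  wochoice.well_order R /\
  forall x, card_lt [set y | R y x /\ y <> x] [set: T].

Definition cofinal R C : Prop := forall x, exists2 y, C y & R x y.

(* The cofinality of [R] is the cardinality of [K].                            *)
Definition cofinality_is R (U : Type) (K : set U) : Prop :=
  (exists2 C, cofinal R C & C #= K) /\ (forall C, cofinal R C -> K #<= C).

Definition regular_cardinal : Prop :=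
  infinite_set [set: T] /\
  exists2 R, initial_well_order R & cofinality_is R [set: T].

End CardinalOfType.

Section Groups.
Variable G : groupType.
Implicit Types (A F S : set G) (tau : topology G).

Definition left_invariant tau : Prop :=
  forall g : G, continuous ((fun x : G => g * x) : tau -> tau).

Definition left_large A : Prop :=
  exists2 F, card_lt F [set: G] & [set f * a | f in F & a in A] = [set: G].

Definition card_bounded tau : Prop :=
  forall U : set G, nbhs ((1 : G) : tau) U -> left_large U.

(* Universal property of the inclusion of [S]; since [H] is inhabited, every   *)
(* function on [S] is the restriction of some [f : G -> H].                    *)
Definition free_basis S : Prop :=
  forall (H : groupType) (f : G -> H),
    exists phi : {multiplicative G -> H},
      (forall s, S s -> phi s = f s) /\
      (forall psi : {multiplicative G -> H},
        (forall s, S s -> psi s = f s) -> psi =1 phi).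

Definition free_group : Prop := exists S, free_basis S.

End Groups.

(* Main.v *)
Require Import Defs.
From HB Require Import structures.
From mathcomp Require Import all_boot monoid.
From mathcomp Require Import all_classical.
From mathcomp Require Import topology_structure.
From Stdlib Require Import Relation_Operators Wellfounded Wf_nat.

Set Implicit Arguments.
Unset Strict Implicit.
Unset Printing Implicit Defensive.

Local Open Scope classical_set_scope.
Local Open Scope card_scope.
Local Open Scope group_scope.

(** Call a subset of [G] small when its cardinality is less than that of [G].
    A subset [D] containing a right translate of every small set meets every left
    large [U]: if [G = F * U] with [F] small, choose [g] with [F^-1 * g] included
    in [D] and write [g = f * u]; then [u = f^-1 * g] lies in both [U] and [D].
    Suppose that [G] is coloured with three colours, each of whose classes
    has this property ([thick_coloring]).  For a left invariant card-bounded
    topology, every nonempty open set then meets all three colours.  Adjoin to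
    the topology the union of two colour classes.  This set was not open, since
    it misses the third colour; and no point becomes isolated, since every
    nonempty set of the new topology still meets two colours.  So the topology
    was not maximal ([not_maximal_of_thick_coloring]).

    It remains to colour [G].  If the cardinal of [G] is regular, small means
    bounded in an initial well-order, and small unions of small sets are small.
    A transfinite recursion chooses pairwise disjoint right translates of the
    initial segments, three for each segment, and the three families give the
    colours ([regular_thick_coloring]).

    If [G] is free on an infinite basis [S], the colour of [g] is read off the
    last letters of its reduced word.  A small [F] cannot exhaust [S] with the
    last letters of its elements, because [S] has the cardinality of [G]
    ([free_group_card_le_basis]); a basis element [s] which it leaves out makes
    the words of [F * s^-1], [F * s] and [F * (s * s)] end in the three patterns
    that the colours distinguish ([free_thick_coloring]).  The reduced word
    of [g] is obtained from the universal property, by which the letters' action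
    on words extends to [G].
    That [S] generates [G] follows from the uniqueness in the universal property
    ([free_basis_generates]), and then the cardinality of [G] is bounded through
    [X * X <= X] for infinite [X] ([infinite_square]).  If [S] is finite, [G] is
    countable and the regular case applies. *)

(** * Small sets *)

Section SmallSets.
Variable T : Type.
Definition small (U : Type) (A : set U) : Prop := card_lt A [set: T].

Lemma small_le (U V : Type) (A : set U) (B : set V) :
  A #<= B -> small B -> small A.
Proof.
move=> AB [BT TB]; split; first exact: card_le_trans AB BT.
by move=> TA; apply: TB; exact: card_le_trans TA AB.
Qed.

Lemma small_sub (U : Type) (A B : set U) : A `<=` B -> small B -> small A.
Proof. by move=> /subset_card_le; exact: small_le. Qed.

Lemma small_image (U V : Type) (f : U -> V) (A : set U) :
  small A -> small (f @` A).
Proof. exact/small_le/card_image_le. Qed.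

Lemma small_finite (U : Type) (A : set U) :
  infinite_set [set: T] -> finite_set A -> small A.
Proof.
move=> infT finA; split; last by move=> /card_le_finite /(_ finA).
have [n /card_le_trans] := (finite_set_leP A).1 finA; apply.
apply: card_le_trans ((infiniteP _).1 infT); exact: card_leT.
Qed.

Lemma small_proper (A : set T) : small A -> exists x, ~ A x.
Proof.
move=> [_ TA]; apply: contrapT => /forallNP allA; apply: TA.
by apply: subset_card_le => x _; exact: contrapT (allA x).
Qed.
End SmallSets.
Arguments small T {U} A.

(** * Adjoining a set to a topology *)

Section Adjoin.
Variables (T : Type) (tau : topology T) (D : set T).

Definition adjoin_open : set (set T) :=
  [set W | exists U V : set T,
     [/\ @open tau U, @open tau V & W = U `|` (V `&` D)]].

Lemma adjoin_openT : adjoin_open setT.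
Proof.
by exists setT, set0; split; [exact: openT|exact: open0|rewrite setTU].
Qed.

Lemma adjoin_openI : setI_closed adjoin_open.
Proof.
move=> _ _ [U [V [oU oV ->]]] [U' [V' [oU' oV' ->]]].
exists (U `&` U'), ((U `&` V') `|` (V `&` U') `|` (V `&` V')); split.
- exact: openI.
- by apply: openU; [apply: openU|]; exact: openI.
- by rewrite predeqE => x /=; split; tauto.
Qed.

Lemma adjoin_open_bigcup (I : Type) (f : I -> set T) :
  (forall i, adjoin_open (f i)) -> adjoin_open (\bigcup_i f i).
Proof.
move=> /choice[U] /choice[V] UV.
exists (\bigcup_i U i), (\bigcup_i V i); split.
- by apply: bigcup_open => i _; have [] := UV i.
- by apply: bigcup_open => i _; have [] := UV i.
- rewrite setI_bigcupl -bigcupU; apply: eq_bigcup => // i _; by have [] := UV i.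
Qed.

(** A fresh name for the carrier, so that the new topology does not compete with
    structures already attached to [T]. *)
Definition adjoin_space (_ : topology T) (_ : set T) : Type := T.
HB.instance Definition _ := gen_eqMixin (adjoin_space tau D).
HB.instance Definition _ := gen_choiceMixin (adjoin_space tau D).
HB.instance Definition _ := isOpenTopological.Build (adjoin_space tau D)
  adjoin_openT adjoin_openI adjoin_open_bigcup.

Definition adjoin : topology T := Topological.class (adjoin_space tau D).

Lemma open_adjoin : @open adjoin = adjoin_open.
Proof. by []. Qed.

End Adjoin.

(** * Thick colourings refute maximality *)

(** The colour classes are right thick: each contains a translate of every small
    set.  With three of them, a union of two still has two points in every
    nonempty open set, which rules out isolated points without any separation
    axiom. *)
Definition thick_coloring (G : groupType) (c : G -> 'I_3) : Prop :=
  forall F : set G, small G F ->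
    forall i, exists g, forall f, F f -> c (f * g) = i.

Section Topological.
Variables (G : groupType) (tau : topology G) (c : G -> 'I_3).
Hypotheses (tauL : left_invariant tau) (tauB : card_bounded tau).
Hypothesis cT : thick_coloring c.

(** The translate [u^-1 * U] is a neighbourhood of the identity, so it is left
    large, say [G = F * u^-1 * U]; a translate of [u * F^-1] that has colour [i]
    throughout then meets [U]. *)
Lemma open_meets_color (U : set G) (u : G) i :
  @open tau U -> U u -> exists2 v, U v & c v = i.
Proof.
move=> oU Uu; have /tauB[F sF FU] : nbhs ((1 : G) : tau) [set x | U (u * x)].
  apply: tauL; apply: (@open_nbhs_nbhs tau); split => //=; by rewrite mulg1.
have [g gi] := cT (small_image (fun f => u * f^-1) sF) i.
have : [set: G] g by [].
rewrite -FU => -[f Ff [v Uv fvg]]; exists (u * v) => //.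
by rewrite -(gi (u * f^-1)); [congr c; rewrite -fvg mulgA mulgVK|exists f].
Qed.

Lemma not_maximal_of_thick_coloring : ~ maximal_topology tau.
Proof.
pose D : set G := [set g | c g != ord0].
move=> [_ /(_ (adjoin tau D))].
have subD (U : set G) x : adjoin_open tau D U -> U x ->
    forall i, i != ord0 -> exists2 v, U v & c v = i.
  move=> [V [W [oV oW ->]]] [Vx|[Wx _]] i i0.
    by have [v Vv cv] := open_meets_color i oV Vx; exists v => //; left.
  have [v Wv cv] := open_meets_color i oW Wx.
  by exists v => //; right; split => //; rewrite /D /= cv.
case.
  split=> [U oU|].
    rewrite open_adjoin; exists U, set0.
    by split; [|exact: open0|rewrite set0I setU0].
  move=> oD; have /oD {}oD : @open (adjoin tau D) D.
    rewrite open_adjoin; exists set0, setT.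
    by split; [exact: open0|exact: openT|rewrite set0U setTI].
  have [x _ cx] := open_meets_color ord_max (@openT tau) (I : setT 1).
  have Dx : D x by rewrite /D /= cx.
  by have [y + cy] := open_meets_color ord0 oD Dx; rewrite /D /= cy eqxx.
move=> x [_ [W nW]]; rewrite setIT => Wx.
have [V [oV Vx VW]] : exists V, [/\ adjoin_open tau D V, V x & V `<=` W].
  by move: nW; rewrite nbhsE => -[V [oV Vx] VW]; exists V.
(* [V] lies in the singleton of [x], so [x] would have both colours 1 and 2. *)
have cV i : i != ord0 -> c x = i.
  move=> /(subD _ _ oV Vx) [v /VW Wv <-].
  by move: Wv; rewrite Wx => ->.
by have := cV (@Ordinal 3 1 isT) isT; rewrite (cV (@Ordinal 3 2 isT)).
Qed.
End Topological.

(** * The regular case *)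

(** Transfinite recursion for a choice at [p] constrained by the choices made
    below [p]: [P t p a] may look only at the values of [t] below [p], which is
    what its invariance hypothesis expresses. *)
Lemma wf_recursive_choice (I A : Type) (a0 : A) (lt : I -> I -> Prop)
    (P : (I -> A) -> I -> A -> Prop) :
  well_founded lt -> (forall t p, exists a, P t p a) ->
  (forall t t' p a, (forall q, lt q p -> t q = t' q) -> P t p a -> P t' p a) ->
  exists t, forall p, P t p (t p).
Proof.
move=> wf exP extP.
have /choice[sel selP] : forall t, exists f, forall p, P t p (f p).
  by move=> t; have [f] := choice (exP t); exists f.
pose ext p (rec : forall q, lt q p -> A) q :=
  if pselect (lt q p) is left qp then rec q qp else a0.
pose t := Fix wf (fun _ => A) (fun p rec => sel (ext p rec) p).
have tE p : t p = sel (ext p (fun q _ => t q)) p.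
  rewrite /t Fix_eq // => {}p f g fg; congr (sel (ext p _) p).
  by apply: functional_extensionality_dep => q; apply: funext => qp.
exists t => p; rewrite tE; apply: extP (selP _ _) => q qp.
by rewrite /ext; case: pselect.
Qed.

Section WellOrder.
Variables (T : eqType) (R : rel T).
Hypothesis woR : wochoice.well_order R.

Definition segment (x : T) : set T := [set y | R y x /\ y <> x].

Lemma well_order_min (A : set T) : A !=set0 ->
  exists2 z, A z & forall x, A x -> R z x.
Proof.
move=> [x Ax]; have [|z [[zA zmin] _]] := woR (A := mem A).
  by exists x; exact: mem_set.
by exists z; [exact: set_mem|move=> y Ay; apply: zmin; exact: mem_set].
Qed.

Lemma well_order_total x y : R x y \/ R y x.
Proof.
have [|z [->|->] zmin] := @well_order_min [set x; y]; first by exists x; left.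
  by left; apply: zmin; right.
by right; apply: zmin; left.
Qed.

Lemma well_order_refl x : R x x.
Proof. by case: (well_order_total x x). Qed.

Lemma well_order_anti x y : R x y -> R y x -> x = y.
Proof.
have anti := wochoice.wo_chain_antisymmetric
  (wochoice.withinW (A := predT) woR).
by move=> Rxy Ryx; apply: (anti x y) => //; rewrite Rxy Ryx.
Qed.

Lemma well_order_trans x y z : R x y -> R y z -> R x z.
Proof.
move=> Rxy Ryz.
have [|t [[->|->]|->] tmin] := @well_order_min [set x; y; z].
- by exists x; left; left.
- by apply: tmin; right.
- by rewrite (well_order_anti Rxy) //; apply: tmin; left; left.
- by rewrite -(well_order_anti Ryz) //; apply: tmin; left; right.
Qed.

Lemma segment_trans x y z : segment y x -> segment z y -> segment z x.
Proof.
move=> [Rxy nxy] [Ryz nyz]; split; first exact: well_order_trans Ryz.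
by move=> xz; apply: nxy; apply: well_order_anti Rxy _; rewrite xz.
Qed.

Lemma segmentVge x y : segment x y \/ R x y.
Proof.
have [->|/eqP yx] := eqVneq y x; first by right; exact: well_order_refl.
by case: (well_order_total x y) => Rxy; [right|left].
Qed.

Lemma segment_wf : well_founded (fun y x => segment x y).
Proof.
move=> x; apply: contrapT => nx.
have [|z nz zmin] := @well_order_min [set y | ~ Acc (fun y x => segment x y) y].
  by exists x.
apply: nz; constructor => y [Ryz yz]; apply: contrapT => /zmin Rzy.
by apply: yz; exact: well_order_anti.
Qed.
End WellOrder.

Section Regular.
Variables (T : eqType) (R : rel T).
Hypothesis infT : infinite_set [set: T].
Hypothesis iwoR : initial_well_order R.
Hypothesis cofR : cofinality_is R [set: T].
Let woR := iwoR.1.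

(** Regularity enters here: an unbounded set is cofinal in [R], hence at
    least as large as the cofinality, which is the cardinal of [T] itself. *)
Lemma small_segmentP (A : set T) : small T A <-> exists x, A `<=` segment R x.
Proof.
split=> [[_ TA]|[x Ax]]; last exact: small_sub (iwoR.2 x).
apply: contrapT => /forallNP Aun; apply/TA/cofR.2 => x.
have /existsNP[y /not_implyP[Ay nyx]] := Aun x.
by exists y => //; case: (segmentVge woR x y).
Qed.

(** Bound each [B i] by some [b i]; the [b i] form a small set, so they have a
    common bound. *)
Lemma small_bigcup (U : Type) (I : set U) (B : U -> set T) :
  small T I -> (forall i, I i -> small T (B i)) -> small T (\bigcup_(i in I) B i).
Proof.
move=> sI sB.
have /choice[b bB] : forall i, exists x, I i -> B i `<=` segment R x.
  move=> i; case: (pselect (I i)) => [/sB/small_segmentP[x]|nI]; first by exists x.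
  by have [x _] := infinite_setN0 infT; exists x.
have /small_segmentP[x bx] := small_image b sI.
apply/small_segmentP; exists x => y [i Ii /(bB i Ii) yb].
by apply: segment_trans yb _ => //; apply: bx; exists i.
Qed.

(** [R] has no last element, because singletons are small, hence bounded. *)
Lemma small_le_segment x : small T [set y | R y x].
Proof.
have /small_segmentP[z xz] := small_finite infT (finite_set1 x).
apply/small_segmentP; exists z => y /= Ryx.
have [Rxz nxz] := xz x erefl; split; first exact: well_order_trans Rxz.
by move=> yz; apply: nxz; apply: well_order_anti Rxz _ => //; rewrite -yz.
Qed.
End Regular.

Section RegularGroup.
Variables (G : groupType) (R : rel G).
Hypothesis infG : infinite_set [set: G].
Hypothesis iwoR : initial_well_order R.
Hypothesis cofR : cofinality_is R [set: G].
Let woR := iwoR.1.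

(** Three translates are wanted of each segment, so the recursion runs over pairs
    of a point and a colour, ordered lexicographically. *)
Let index : Type := (G * 'I_3)%type.
Let lt : index -> index -> Prop :=
  slexprod G 'I_3 (fun y x => segment R x y) (fun i j => (i < j)%N).

Lemma index_lt_wf : well_founded lt.
Proof.
apply: wf_slexprod; first exact: segment_wf.
by apply: (@well_founded_lt_compat _ (@nat_of_ord 3)) => i j /ltP.
Qed.

Lemma index_lt_fst p q : lt p q -> R p.1 q.1.
Proof. by case=> [? ? ? ? []|x *] //=; exact: (well_order_refl woR). Qed.

Lemma index_lt_total p q : p <> q -> lt p q \/ lt q p.
Proof.
case: p q => [x i] [y j] pq.
have [xy|xy] := pselect (x = y).
  rewrite {}xy in pq *; case: (ltngtP i j) => ij.
  - by left; exact: right_slex.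
  - by right; exact: right_slex.
  - by case: pq; congr pair; exact: val_inj.
by case: (well_order_total woR x y) => Rxy; [left|right]; apply: left_slex;
  split => // /esym.
Qed.

(** The elements [g] to be avoided form [A^-1 * B], which is small. *)
Lemma small_translate_avoid (A B : set G) :
  small G A -> small G B -> exists g, forall a, A a -> ~ B (a * g).
Proof.
move=> sA sB.
have /small_proper[g ng] :
    small G (\bigcup_(a in A) ((fun b => a^-1 * b) @` B)).
  by apply: (small_bigcup infG iwoR cofR) => // a _; exact: small_image.
exists g => a Aa Bag; apply: ng; exists a => //.
by exists (a * g) => //; rewrite mulKg.
Qed.

Let used (t : index -> G) (p : index) : set G :=
  \bigcup_(q in [set q | lt q p]) [set a * t q | a in segment R q.1].

Lemma small_used t p : small G (used t p).
Proof.
pose B := \bigcup_(i in [set: 'I_3]) \bigcup_(x in [set x | R x p.1])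
  [set a * t (x, i) | a in segment R x].
apply: (@small_sub _ _ _ B).
  move=> b [[x i] xip [a ax <-]]; exists i => //; exists x; last by exists a.
  exact: index_lt_fst xip.
apply: (small_bigcup infG iwoR cofR) => [|i _].
  by apply: small_finite => //; exact: finite_finset.
apply: (small_bigcup infG iwoR cofR) => [|x _].
  exact: (small_le_segment infG iwoR cofR).
by apply: small_image; exact: iwoR.2.
Qed.

Lemma disjoint_translates : exists t : index -> G, forall p q a b, p <> q ->
  segment R p.1 a -> segment R q.1 b -> a * t p <> b * t q.
Proof.
pose avoid (t : index -> G) p g :=
  forall a, segment R p.1 a -> ~ used t p (a * g).
have [||t tP] := @wf_recursive_choice _ G 1 lt avoid index_lt_wf.
- by move=> t p; exact: small_translate_avoid (iwoR.2 _) (small_used t p).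
- move=> t t' p g tt' tg a ap [q qp [b bq bE]]; apply: (tg a ap).
  by exists q => //; exists b => //; rewrite tt'.
exists t => p q a b pq ap bq abE; case: (index_lt_total pq) => [pltq|qltp].
- by apply: (tP q b bq); exists p => //; exists a.
- by apply: (tP p a ap); exists q => //; exists b.
Qed.

(** A small set lies in some segment, of which each colour class contains a
    translate; points in no translate get the default colour. *)
Lemma regular_thick_coloring : exists c : G -> 'I_3, thick_coloring c.
Proof.
have [t tP] := disjoint_translates.
pose piece g (i : 'I_3) := exists x a, segment R x a /\ g = a * t (x, i).
exists (fun g => xget ord0 (piece g)) => F /(small_segmentP iwoR cofR)[x Fx] i.
exists (t (x, i)) => f /Fx fx; case: xgetP => [j _ [y [b [yb E]]]|/(_ i) []].
  apply: contrapT => ji; apply: (tP (x, i) (y, j) f b) => //.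
  by move=> [_ ij]; apply: ji.
by exists x, f.
Qed.
End RegularGroup.

Section Countable.
Variable T : choiceType.
Hypotheses (infT : infinite_set [set: T]) (cT : countable [set: T]).

(** An injection into [nat] well-orders [T] with finite initial segments, so every
    cofinal set is infinite. *)
Lemma countable_regular : regular_cardinal T.
Proof.
have /countable_injP[f finj] := cT.
have {}finj x y : f x = f y -> x = y by move=> fxy; apply: finj => //; exact: in_setT.
have fin_below x : finite_set [set y | (f y <= f x)%N].
  apply: (@card_le_finite _ _ _ `I_(f x).+1); last exact: finite_II.
  rewrite -(card_le_eql (@inj_card_eq _ _ _ f _)); last first.
    by move=> ? ? _ _; exact: finj.
  by apply: subset_card_le => _ [y yx <-]; rewrite /= ltnS.
split=> //; exists (fun x y => (f x <= f y)%N); split.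
- apply: wochoice.antisymmetric_well_order => [x y /anti_leq/finj //|A [x Ax]].
  have exA : exists n, `[< exists2 y, y \in A & f y = n >].
    by exists (f x); apply/asboolP; exists x.
  have [n /asboolP[y Ay <-] ymin] := ex_minnP exA.
  by exists y; split => // z Az; apply: ymin; apply/asboolP; exists z.
- move=> x; apply: small_finite => //; apply: sub_finite_set (fin_below x).
  by move=> y [].
- by exists [set: T]; [move=> x; exists x|exact: card_eqxx].
- move=> C Ccof; apply: card_le_trans ((infiniteP C).1 _); first exact: cT.
  move=> finC; apply: infT.
  apply: sub_finite_set (bigcup_finite finC (fun c _ => fin_below c)).
  by move=> x _; have [c Cc xc] := Ccof x; exists c.
Qed.
End Countable.

(** * Cardinal arithmetic: squares and sequences *)

Lemma injective_card_le (T U : Type) (A : set T) (B : set U) (f : T -> U) :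
  (forall x, A x -> B (f x)) ->
  (forall x y, A x -> A y -> f x = f y -> x = y) -> A #<= B.
Proof.
move=> fAB finj; apply: card_le_trans (subset_card_le (A := f @` A) _).
  rewrite (card_le_eqr (inj_card_eq _)) ?card_lexx //.
  move=> x y /set_mem Ax /set_mem Ay.
  exact: finj.
by move=> _ [x /fAB Bfx <-].
Qed.

Lemma card_le_injective (T U : Type) (A : set T) (B : set U) : U -> A #<= B ->
  exists2 f : T -> U, (forall x, A x -> B (f x)) &
    forall x y, A x -> A y -> f x = f y -> x = y.
Proof.
elim/Ppointed: U => U in B *; first by move=> u; case: (no u).
move=> _ /pcard_leP/injfunPex[f fAB finj]; exists f => // x y Ax Ay.
by apply: finj; exact: mem_set.
Qed.

(** A maximal one-to-one relation between [A] and [B] exhausts one of them. *)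
Lemma card_le_total (T U : Type) (A : set T) (B : set U) : A #<= B \/ B #<= A.
Proof.
pose P (M : set (T * U)) := (forall p, M p -> A p.1 /\ B p.2) /\
  forall p q, M p -> M q -> p.1 = q.1 <-> p.2 = q.2.
have [|M [[MAB Minj] Mmax]] := @Zorn_bigcup _ P.
  move=> F FP totF; split=> [p [X /FP[XAB _]]|p q [X FX Xp] [Y FY Yq]].
    exact: XAB.
  have [XY|YX] := totF _ _ FX FY.
    by apply: (FP _ FY).2 => //; exact: XY.
  by apply: (FP _ FX).2 => //; exact: YX.
have [Adom|/existsNP[x /not_implyP[Ax nx]]] :=
    pselect (forall x, A x -> exists p, M p /\ p.1 = x).
  left; apply: (@card_le_trans _ _ _ M).
    apply: card_le_trans (card_image_le fst M).
    by apply: subset_card_le => x /Adom[p [Mp <-]]; exists p.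
  apply: (@injective_card_le _ _ _ _ snd) => [p /MAB[]//|p q Mp Mq pq].
  by have := (Minj p q Mp Mq).2 pq; case: p q pq {Mp Mq} => ? ? [? ?] /= -> ->.
have [Bdom|/existsNP[y /not_implyP[By ny]]] :=
    pselect (forall y, B y -> exists p, M p /\ p.2 = y).
  right; apply: (@card_le_trans _ _ _ M).
    apply: card_le_trans (card_image_le snd M).
    by apply: subset_card_le => y /Bdom[p [Mp <-]]; exists p.
  apply: (@injective_card_le _ _ _ _ fst) => [p /MAB[]//|p q Mp Mq pq].
  by have := (Minj p q Mp Mq).1 pq; case: p q pq {Mp Mq} => ? ? [? ?] /= -> ->.
exfalso; apply: (Mmax (M `|` [set (x, y)])).
  split=> [p|]; [by left|move=> /(_ (x, y) (or_intror erefl)) Mxy].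
  by apply: nx; exists (x, y).
split=> [p [/MAB//|->//]|p q [Mp|->] [Mq|->] //=]; first exact: Minj.
- by split=> pE; [case: nx|case: ny]; exists p.
- by split=> qE; [case: nx|case: ny]; exists q.
Qed.

Lemma infinite_neq (T : Type) (a : T) :
  infinite_set [set: T] -> exists b, b <> a.
Proof.
move=> infT; apply: contrapT => /forallNP allA; apply: infT.
by apply: sub_finite_set (finite_set1 a) => x _; exact: contrapT (allA x).
Qed.

Section Square.
Variable T : Type.

(* Injections from [A * A] to [A], with [A] varying, are represented by their
   graphs, so that unions of chains and maximality are about plain sets; [A] is
   recovered from the diagonal. *)
Let dom (M : set (T * T * T)) : set T := [set x | exists z, M (x, x, z)].

Let pairing (M : set (T * T * T)) : Prop :=
  [/\ forall p q, M p -> M q -> p.1 = q.1 <-> p.2 = q.2,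
      forall x y z, M (x, y, z) -> [/\ dom M x, dom M y & dom M z] &
      forall x y, dom M x -> dom M y -> exists z, M (x, y, z)].

Let graph (A : set T) (f : T -> T -> T) : set (T * T * T) :=
  [set p | [/\ A p.1.1, A p.1.2 & p.2 = f p.1.1 p.1.2]].

Let injective2_on (A : set T) (f : T -> T -> T) : Prop :=
  (forall x y, A x -> A y -> A (f x y)) /\
  forall x y x' y', A x -> A y -> A x' -> A y' ->
    f x y = f x' y' -> x = x' /\ y = y'.

Lemma dom_graph A f : dom (graph A f) = A.
Proof.
by rewrite predeqE => x; split=> [[z [] //]|Ax]; exists (f x x); split.
Qed.

Lemma graph_pairing A f : injective2_on A f -> pairing (graph A f).
Proof.
move=> [fA finj]; split; rewrite ?dom_graph.
- move=> [[x y] z] [[x' y'] z'] [/= Ax Ay ->] [/= Ax' Ay' ->].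
  by split=> [[-> ->]//|E]; have [-> ->] := finj _ _ _ _ Ax Ay Ax' Ay' E.
- by move=> x y _ [/= Ax Ay ->]; split=> //; exact: fA.
- by move=> x y Ax Ay; exists (f x y); split.
Qed.

Lemma pairing_graph M : pairing M ->
  exists f, injective2_on (dom M) f /\ M = graph (dom M) f.
Proof.
move=> [Minj Mdom Mtot].
have /choice[f fP] : forall p : T * T, exists z,
    dom M p.1 -> dom M p.2 -> M (p, z).
  move=> [x y]; case: (pselect (dom M x /\ dom M y)) => [[/= Dx Dy]|nD].
    by have [z] := Mtot _ _ Dx Dy; exists z.
  by exists x => /= Dx Dy; case: nD.
exists (fun x y => f (x, y)); split.
  split=> [x y Dx Dy|x y x' y' Dx Dy Dx' Dy' fE].
    by have [] := Mdom _ _ _ (fP (x, y) Dx Dy).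
  by have [] := (Minj _ _ (fP (x, y) Dx Dy) (fP (x', y') Dx' Dy')).2 fE.
rewrite predeqE => -[[x y] z]; split=> [Mxyz|[/= Dx Dy ->]]; last exact: fP.
have [Dx Dy _] := Mdom _ _ _ Mxyz; split=> //=.
by apply: (Minj _ _ Mxyz (fP (x, y) Dx Dy)).1.
Qed.

Lemma pairing_bigcup (F : set (set (T * T * T))) :
  F `<=` pairing -> total_on F subset -> pairing (\bigcup_(M in F) M).
Proof.
move=> FP totF.
have dir X Y : F X -> F Y -> exists Z, [/\ F Z, X `<=` Z & Y `<=` Z].
  by move=> FX FY; case: (totF _ _ FX FY) => XY; [exists Y|exists X]; split.
split.
- move=> p q [X FX Xp] [Y FY Yq]; have [Z [FZ XZ YZ]] := dir _ _ FX FY.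
  by have [Zinj _ _] := FP _ FZ; apply: Zinj; [exact: XZ|exact: YZ].
- move=> x y z [X FX Xxyz]; have [_ Xdom _] := FP _ FX.
  by have [[a ?] [b ?] [c ?]] := Xdom _ _ _ Xxyz;
    split; [exists a|exists b|exists c]; exists X.
- move=> x y [a [X FX Xa]] [b [Y FY Yb]]; have [Z [FZ XZ YZ]] := dir _ _ FX FY.
  have [_ _ Ztot] := FP _ FZ.
  have [||z Zz] := Ztot x y; first by exists a; exact: XZ.
    by exists b; exact: YZ.
  by exists z, Z.
Qed.

Lemma maximal_pairing_above M0 : pairing M0 ->
  exists M, [/\ pairing M, M0 `<=` M & forall N, pairing N -> M `<=` N -> N = M].
Proof.
move=> PM0; have [|M [PM Mmax]] := @Zorn_bigcup _ [set M | pairing (M0 `|` M)].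
  move=> F FP totF; rewrite /=.
  have -> : M0 `|` \bigcup_(X in F) X =
      \bigcup_(X in M0 |` ((fun X => M0 `|` X) @` F)) X.
    rewrite predeqE => p; split=> [[M0p|[X FX Xp]]|[X [->|[Y FY <-]]]].
    - by exists M0 => //; left.
    - by exists (M0 `|` X); [right; exists X|right].
    - by left.
    - by move=> [?|?]; [left|right; exists Y].
  apply: pairing_bigcup => [_ [->//|[X FX <-]]|]; first exact: FP.
  move=> _ _ [->|[X FX <-]] [->|[Y FY <-]].
  - by left.
  - by left=> p; left.
  - by right=> p; left.
  - by case: (totF _ _ FX FY) => XY; [left|right]; exact: setUS.
exists (M0 `|` M); split=> // N PN MN.
apply: contrapT => NM; apply: (Mmax N); last first.
  by rewrite /= (_ : M0 `|` N = N) //; apply/setUidPr => p ?; apply: MN; left.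
split=> [p Mp|NsubM]; first by apply: MN; right.
by apply: NM; rewrite predeqE => p; split=> [/NsubM|/MN //]; right.
Qed.

(** The set [C] consists of [A] and of a part injected into [A] by [g]; send the
    two parts to the disjoint images of [f a] and [f b]. *)
Lemma injective2_absorb A f a b (C : set T) g :
  injective2_on A f -> A a -> A b -> a <> b ->
  (forall x, C x -> ~ A x -> A (g x)) ->
  (forall x y, C x -> C y -> ~ A x -> ~ A y -> g x = g y -> x = y) ->
  exists k : T -> T, (forall x, C x -> A (k x)) /\
    (forall x y, C x -> C y -> k x = k y -> x = y).
Proof.
move=> [fA finj] Aa Ab ab gA ginj.
exists (fun x => if pselect (A x) is left _ then f a x else f b (g x)); split.
  by move=> x Cx; case: pselect => nAx; apply: fA => //; exact: gA.
move=> x y Cx Cy; case: pselect => Ax; case: pselect => Ay.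
- by case/finj.
- by case/finj => //; exact: gA.
- by case/finj => //; [exact: gA|move=> /esym].
- by case/finj; try exact: gA; move=> // _; exact: ginj.
Qed.

(** Take a maximal injection from [A * A] to [A] that extends one given by the
    squares of a countable subset.  If the complement of [A] embeds in [A], then
    [T] does, and so [T * T] embeds in [A].  Otherwise [A] has a disjoint copy
    [B]: since [A] and [B] together embed in [A], the pairs outside [A * A] can be
    sent injectively to [B], which contradicts maximality. *)
Lemma infinite_square : infinite_set [set: T] ->
  exists f : T * T -> T, injective f.
Proof.
move=> infT.
have [i _ iinj'] : exists2 i : nat -> T, (forall n, setT n -> [set: T] (i n)) &
    forall m n, setT m -> setT n -> i m = i n -> m = n.
  have [t _] := infinite_setN0 infT.
  exact: card_le_injective t ((infiniteP _).1 infT).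
have iinj : injective i by move=> m n; exact: iinj'.
have /choice[j jP] : forall x, exists n, range i x -> i n = x.
  by move=> x; case: (pselect (range i x)) => [[n _ <-]|]; [exists n|exists 0%N].
have ji n : j (i n) = n by apply: iinj; apply: jP; exists n.
have P0 : injective2_on (range i) (fun x y => i (pickle (j x, j y))).
  split=> [x y _ _|_ _ _ _ [m _ <-] [n _ <-] [m' _ <-] [n' _ <-]].
    by exists (pickle (j x, j y)).
  by rewrite !ji => /iinj/(pcan_inj pickleK)[-> ->].
have [M [PM M0M Mmax]] := maximal_pairing_above (graph_pairing P0).
have [f [finj Mf]] := pairing_graph PM; set A := dom M in finj Mf.
have Ai n : A (i n).
  exists (i (pickle (n, n))); apply: M0M; split; [by exists n|by exists n|].
  by rewrite /= ji.
have i01 : i 0%N <> i 1%N by move=> /iinj.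
have [/(card_le_injective (i 0%N))|/(card_le_injective (i 0%N))] :=
  card_le_total (~` A) A.
  move=> [g gA ginj].
  have [k [kA kinj]] := @injective2_absorb A f (i 0%N) (i 1%N) [set: T] g finj
    (Ai 0%N) (Ai 1%N) i01 (fun x _ => gA x) (fun x y _ _ => ginj x y).
  exists (fun p => f (k p.1) (k p.2)) => -[x y] [x' y'] /= /finj.2 [].
  - exact: kA.
  - exact: kA.
  - exact: kA.
  - exact: kA.
  - by move=> /kinj -> // /kinj -> .
move=> [h hA hinj].
pose C := A `|` h @` A.
have /choice[g gP] : forall x, exists y, (h @` A) x -> A y /\ h y = x.
  move=> x; case: (pselect ((h @` A) x)) => [[y Ay <-]|nx]; first by exists y.
  by exists x.
have Ch x : C x -> ~ A x -> (h @` A) x by case.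
have [||k [kA kinj]] := @injective2_absorb A f (i 0%N) (i 1%N) C g finj
    (Ai 0%N) (Ai 1%N) i01.
- by move=> x /Ch/[apply]/gP[].
- by move=> x y /Ch Cx /Ch Cy /Cx/gP[_ {2}<-] /Cy/gP[_ {2}<-] ->.
pose f' x y :=
  if pselect (A x /\ A y) is left _ then f x y else h (f (k x) (k y)).
have Af x y : C x -> C y -> A (f (k x) (k y)).
  by move=> Cx Cy; apply: finj.1; exact: kA.
have /graph_pairing/Mmax : injective2_on C f'.
  split=> [x y Cx Cy|x y x' y' Cx Cy Cx' Cy'].
    rewrite /f'; case: pselect => [[Ax Ay]|_]; first by left; exact: finj.1.
    by right; exists (f (k x) (k y)) => //; exact: Af.
  rewrite /f'; case: pselect => [[Ax Ay]|_]; case: pselect => [[Ax' Ay']|_].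
  - exact: finj.2.
  - by move=> E; case: (hA _ (Af _ _ Cx' Cy')); rewrite -E; exact: finj.1.
  - by move=> E; case: (hA _ (Af _ _ Cx Cy)); rewrite E; exact: finj.1.
  - move=> /(hinj _ _ (Af _ _ Cx Cy) (Af _ _ Cx' Cy')).
    case/(finj.2 _ _ _ _ (kA _ Cx) (kA _ Cy) (kA _ Cx') (kA _ Cy')).
    by move=> /kinj -> // /kinj -> .
move=> CM; have {}CM : graph C f' = M.
  apply: CM; move=> [[x y] z]; rewrite Mf => -[/= Ax Ay ->].
  split; [by left|by left|].
  by rewrite /= /f'; case: pselect => // -[].
have Ahi : A (h (i 0%N)).
  have : dom (graph C f') (h (i 0%N)) by rewrite dom_graph; right; exists (i 0%N).
  by rewrite CM.
by case: (hA _ (Ai 0%N)).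
Qed.

Lemma infinite_seq : infinite_set [set: T] ->
  exists e : seq T -> T, injective e.
Proof.
move=> infT; have [q qinj] := infinite_square infT.
have [a _] := infinite_setN0 infT.
have [b ba] := infinite_neq a infT.
(* Tagging by [a] keeps the code of a nonempty sequence away from [q (b, b)]. *)
exists (foldr (fun x r => q (a, q (x, r))) (q (b, b))).
elim=> [|x s IHs] [|y t] //=.
- by move=> /qinj[].
- by move=> /qinj[/esym].
- by move=> /qinj[/qinj[-> /IHs ->]].
Qed.
End Square.

(** * Permutation groups *)

Section Permutations.
Variable T : Type.

Record permutation : Type := Permutation {
  permute :> T -> T;
  permute_inv : T -> T;
  permuteK : cancel permute permute_inv;
  permute_invK : cancel permute_inv permute }.

Lemma permutation_ext (s t : permutation) : s =1 t -> s = t.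
Proof.
case: s t => [f f' fK f'K] [g g' gK g'K] /= /funext fg.
rewrite {}fg in fK f'K *.
have f'g' : f' = g' by apply: funext => x; rewrite -[LHS]gK f'K.
rewrite {}f'g' in fK f'K *; congr Permutation; exact: Prop_irrelevance.
Qed.

Definition perm_one := @Permutation id id (frefl _) (frefl _).
Definition perm_inv (s : permutation) :=
  Permutation (@permute_invK s) (@permuteK s).
Definition perm_mul (s t : permutation) :=
  Permutation (can_comp (@permuteK s) (@permuteK t))
    (can_comp (@permute_invK t) (@permute_invK s)).

Lemma perm_mulA : associative perm_mul.
Proof. by move=> s t u; exact: permutation_ext. Qed.
Lemma perm_1mul : left_id perm_one perm_mul.
Proof. by move=> s; exact: permutation_ext. Qed.
Lemma perm_mul1 : right_id perm_one perm_mul.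
Proof. by move=> s; exact: permutation_ext. Qed.
Lemma perm_mulV : left_inverse perm_one perm_inv perm_mul.
Proof. by move=> s; apply: permutation_ext => x; exact: permuteK. Qed.
Lemma perm_mulrV : right_inverse perm_one perm_inv perm_mul.
Proof. by move=> s; apply: permutation_ext => x; exact: permute_invK. Qed.

HB.instance Definition _ := gen_eqMixin permutation.
HB.instance Definition _ := gen_choiceMixin permutation.
HB.instance Definition _ := isGroup.Build permutation
  perm_mulA perm_1mul perm_mul1 perm_mulV perm_mulrV.

Lemma permM (s t : permutation) x : (s * t) x = s (t x).
Proof. by []. Qed.
End Permutations.

(** * Free groups *)

Section Generation.
Variables (G : groupType) (S : set G).
Hypothesis freeS : free_basis S.

Definition word_value (w : seq (bool * S)) : G :=
  foldr (fun l x => (if l.1 then val l.2 else (val l.2)^-1) * x) 1 w.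

Let generated : set G := range word_value.

Lemma generated_mul s g : S s -> generated (s * g) <-> generated g.
Proof.
move=> Ss; split=> [[w _ sgE]|[w _ <-]].
  exists ((false, exist _ s (mem_set Ss)) :: w) => //=.
  by rewrite sgE mulKg.
by exists ((true, exist _ s (mem_set Ss)) :: w).
Qed.

Let shift (g : G) (A : G -> bool) : G -> bool := fun x => A (g^-1 * x).
Lemma shiftK g : cancel (shift g) (shift g^-1).
Proof. by move=> A; apply: funext => x; rewrite /shift invgK mulKg. Qed.
Lemma shiftVK g : cancel (shift g^-1) (shift g).
Proof. by move=> A; apply: funext => x; rewrite /shift invgK mulVKg. Qed.
Let shift_perm (g : G) := Permutation (@shiftK g) (@shiftVK g).

(* [G] acts on its subsets by translation, and [chi] is the subset generated by
   [S].  Conjugating this action by the symmetric difference with [chi] does not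
   change the action of [S], since [chi] is invariant under [S]. *)
Let chi (x : G) : bool := `[< generated x >].
Let flip (A : G -> bool) : G -> bool := fun x => A x (+) chi x.
Lemma flipK : involutive flip.
Proof. by move=> A; apply: funext => x; rewrite /flip addbK. Qed.
Let flip_perm := Permutation flipK flipK.
Let twisted_perm (g : G) := flip_perm * shift_perm g * flip_perm.

Lemma shift_permM : {morph shift_perm : g h / g * h}.
Proof.
move=> g h; apply: permutation_ext => A; apply: funext => x.
by rewrite permM /= /shift invgM mulgA.
Qed.
Lemma twisted_permM : {morph twisted_perm : g h / g * h}.
Proof.
move=> g h; rewrite /twisted_perm shift_permM; apply: permutation_ext => A.
by rewrite !permM /= flipK.
Qed.

HB.instance Definition _ := isMultiplicative.Build G _ shift_perm shift_permM.
HB.instance Definition _ := isMultiplicative.Build G _ twisted_perm twisted_permM.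

(** The translation action and its conjugate by [flip] agree on [S], hence are
    equal; at the empty subset this says that [chi] is invariant under all of
    [G], so that it contains [g * 1]. *)
Lemma free_basis_generates g : exists w, word_value w = g.
Proof.
have [phi [_ uniq]] := freeS shift_perm.
have twE : (twisted_perm : {multiplicative G -> _}) =1 phi.
  apply: uniq => s Ss; apply: permutation_ext => A; apply: funext => x.
  rewrite !permM /= /flip /shift /=.
  have -> : chi x = chi (s^-1 * x).
    by apply: asbool_equiv_eq; have := generated_mul (s^-1 * x) Ss; rewrite mulVKg.
  by rewrite addbK.
have shE := uniq (shift_perm : {multiplicative G -> _}) (fun _ _ => erefl).
have := twE g; rewrite -shE.
move/(congr1 (fun s : permutation _ => s (fun=> false) g)).
rewrite /= /flip /shift /= mulVg.
have -> : chi 1 = true by apply/asboolP; exists [::].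
by move=> /negbFE/asboolP[w _]; exists w.
Qed.
End Generation.

Section FreeCardinality.
Variables (G : groupType) (S : set G).
Hypothesis freeS : free_basis S.

Lemma free_group_card_le_words : [set: G] #<= [set: seq (bool * S)].
Proof.
apply: card_le_trans (card_image_le (@word_value G S) setT).
apply: subset_card_le => g _.
by have [w <-] := free_basis_generates freeS g; exists w.
Qed.

Lemma free_group_card_le_basis : infinite_set S -> [set: G] #<= S.
Proof.
move=> infS; apply: card_le_trans free_group_card_le_words _.
have infST : infinite_set [set: S].
  by move=> finS; apply: infS; rewrite -(eq_finite_set (card_setT S)).
have [e einj] := infinite_seq infST.
have [q qinj] := infinite_square infST.
have [a _] := infinite_setN0 infST.
have [b ba] := infinite_neq a infST.
pose code (l : bool * S) := q (if l.1 then a else b, l.2).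
have code_inj : injective code.
  by move=> [[] x] [[] y] /qinj[] // => [->|/esym|->].
rewrite (card_le_eqr (card_setT_sym S)).
apply: (@injective_card_le _ _ _ _ (e \o map code)) => // x y _ _ /einj.
exact: inj_map code_inj _ _.
Qed.

Lemma free_group_countable : finite_set S -> countable [set: G].
Proof.
move=> finS.
have /finite_set_countable/countable_injP[f finj] : finite_set [set: S].
  by rewrite (eq_finite_set (card_setT S)).
apply: card_le_trans free_group_card_le_words _.
pose code (w : seq (bool * S)) := pickle (map (fun l => (l.1, f l.2)) w).
apply: (@injective_card_le _ _ _ _ code) => // v w _ _ /(pcan_inj pickleK).
apply: inj_map => -[a x] [b y] [-> fxy]; congr pair.
by apply: finj => //; exact: mem_set.
Qed.

End FreeCardinality.

(** * Reduced words *)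

Section Words.
Variable A : eqType.
Implicit Types (l m : bool * A) (w : seq (bool * A)).

(** The letter [(true, x)] stands for [x], and [(false, x)] for its inverse. *)
Definition inv_letter l : bool * A := (~~ l.1, l.2).
Definition reduced w : bool := sorted (fun l m => m != inv_letter l) w.
Definition push l w : seq (bool * A) :=
  if w is m :: v then if m == inv_letter l then v else l :: w else [:: l].

Lemma inv_letterK : involutive inv_letter.
Proof. by move=> [b x]; rewrite /inv_letter negbK. Qed.

Lemma reduced_push l w : reduced w -> reduced (push l w).
Proof.
case: w => [//|m w] rw /=; case: ifP => [_|/negbT lm].
  exact: path_sorted rw.
by rewrite /reduced /= lm.
Qed.

Lemma pushK l w : reduced w -> push (inv_letter l) (push l w) = w.
Proof.
case: w => [|m w] rw /=; first by rewrite inv_letterK eqxx.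
case: ifP => [/eqP mE|_]; last by rewrite /= inv_letterK eqxx.
case: w rw => [|n w] /=; first by rewrite mE.
by rewrite -mE => /andP[/negbTE -> _].
Qed.

Definition reduced_word : Type := {w | reduced w}.
Definition push_word l (w : reduced_word) : reduced_word :=
  exist _ (push l (val w)) (reduced_push l (valP w)).

Lemma push_wordK l : cancel (push_word l) (push_word (inv_letter l)).
Proof. by move=> w; apply: val_inj; exact: pushK (valP w). Qed.

Definition letter_perm (x : A) : permutation reduced_word :=
  Permutation (@push_wordK (true, x)) (@push_wordK (false, x)).

Definition starts_apart (x : A) w : Prop :=
  forall l v, w = l :: v -> l.2 <> x.

(** Three patterns at the front of a word.  If [w] does not start with [x] or its
    inverse, pushing [x] gives colour 0, pushing [x^-1] once gives colour 1, and
    pushing it twice gives colour 2. *)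
Definition color w : 'I_3 :=
  match w with
  | (true, _) :: _ => ord0
  | (false, x) :: (_, y) :: _ =>
      if x == y then @Ordinal 3 2 isT else @Ordinal 3 1 isT
  | _ => @Ordinal 3 1 isT
  end.

Lemma push_fresh x b w : starts_apart x w -> push (b, x) w = (b, x) :: w.
Proof.
case: w => [//|[c y] w] /(_ _ _ erefl) /= yx; case: eqP => // -[_ E].
by case: yx.
Qed.

Lemma push_same l w : push l (l :: w) = l :: l :: w.
Proof. by case: l => [b x] /=; rewrite xpair_eqE; case: b. Qed.
End Words.

Lemma multiplicativeV (G H : groupType) (f : {multiplicative G -> H}) (x : G) :
  f x^-1 = (f x)^-1.
Proof.
have f1 : f 1 = 1 by apply: (mulgI (f 1)); rewrite -gmulfM !mulg1.
by apply: (mulgI (f x)); rewrite -gmulfM !mulgV.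
Qed.

(** * The free case *)

Section FreeColoring.
Variables (G : groupType) (S : set G).
Hypotheses (freeS : free_basis S) (infS : infinite_set S).

(** A letter acts at the front of a word, whereas the elements of [F] are
    multiplied on the right; so the word attached to [g] is the one of [g^-1],
    and multiplying [g] by [s] on the right pushes the inverse of [s]. *)
Lemma free_thick_coloring : exists c : G -> 'I_3, thick_coloring c.
Proof.
have [phi [phiS _]] := freeS (@letter_perm G).
pose word g : seq (bool * G) := val (phi g^-1 (exist _ [::] isT)).
have wordM f s : S s -> word (f * s) = push (false, s) (word f).
  by move=> Ss; rewrite /word invgM gmulfM (multiplicativeV _ s) permM (phiS _ Ss).
have wordV f s : S s -> word (f * s^-1) = push (true, s) (word f).
  by move=> Ss; rewrite /word invgM gmulfM invgK permM (phiS _ Ss).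
exists (fun g => color (word g)) => F [_ GF] i.
pose top f := (head (true, 1) (word f)).2.
have [s [Ss sF]] : exists s, S s /\ ~ (top @` F) s.
  apply: contrapT => /forallNP nS; apply: GF.
  apply: card_le_trans (free_group_card_le_basis freeS infS) _.
  apply: card_le_trans (card_image_le top F); apply: subset_card_le => s Ss.
  by apply: contrapT => sF; case: (nS s).
have fresh f : F f -> starts_apart s (word f).
  by move=> Ff l v wE ls; apply: sF; exists f => //; rewrite /top wE /= ls.
have step f b : F f -> push (b, s) (word f) = (b, s) :: word f.
  by move=> Ff; exact/push_fresh/fresh.
case: i => [[|[|[|//]]] lti].
- exists s^-1 => f Ff /=; rewrite wordV // step //; exact: val_inj.
- exists s => f Ff /=; rewrite wordM // step //.
  case E : (word f) (fresh f Ff) => [|[b t] v] ap; first exact: val_inj.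
  by rewrite /=; case: eqP (ap _ _ erefl) => /= [->//|_ _]; exact: val_inj.
- exists (s * s) => f Ff /=; rewrite mulgA !wordM // step // push_same /= eqxx.
  exact: val_inj.
Qed.
End FreeColoring.

Theorem theorem4 (G : groupType) (infG : infinite_set [set: G])
    (hG : regular_cardinal G \/ free_group G) :
  ~ exists tau : topology G,
      [/\ left_invariant tau, maximal_topology tau & card_bounded tau].
Proof.
have regular_case : regular_cardinal G -> exists c : G -> 'I_3, thick_coloring c.
  by move=> [_ [R iwoR cofR]]; exact: regular_thick_coloring infG iwoR cofR.
have [c cT] : exists c : G -> 'I_3, thick_coloring c.
  case: hG => [//|[S freeS]].
  have [finS|infS] := pselect (finite_set S).
    apply/regular_case/countable_regular => //.
    exact: free_group_countable freeS finS.
  exact: free_thick_coloring freeS infS.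
move=> [tau [tauL tauM tauB]].
exact: not_maximal_of_thick_coloring tauL tauB cT tauM.
Qed.
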